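(* Let $\Phi:X\to X$ be a radius one sand automaton. If there exists a nonzero $m$ such that $m$ appears in every row of the local rule table of $\Phi$, or such that $m$ appears in every column of the local rule table of $\Phi$, then $\Phi$ admits a vertical inducing point of nonzero order.
   Context: Let $\widetilde{\mathbb{Z}}=\mathbb{Z}\cup\{-\infty,+\infty\}$ and $X=\widetilde{\mathbb{Z}}^{\mathbb{Z}}$. For $m\in\mathbb{Z}$, $n\in\widetilde{\mathbb{Z}}$ let $\beta_1^m(n)=+\infty$ if $n>m+1$, $-\infty$ if $n<m-1$, and $n-m$ otherwise, so $\beta_1^m(n)\in\widetilde{\mathcal{A}}_1=\{-\infty,-1,0,1,\infty\}$. A radius one sand automaton with local rule $\phi:\widetilde{\mathcal{A}}_1^{2}\to\{-2,-1,0,1,2\}$ is the map $\Phi:X\to X$ with $\Phi(\mathbf{x})_i=x_i$ if $x_i=\pm\infty$ and $\Phi(\mathbf{x})_i=x_i+\phi(\beta_1^{x_i}(x_{i-1}),\beta_1^{x_i}(x_{i+1}))$ if $x_i\in\mathbb{Z}$. Its local rule table is the $5\times5$ table with rows indexed by the left gradient $L\in\widetilde{\mathcal{A}}_1$, columns by the right gradient $R\in\widetilde{\mathcal{A}}_1$, and entry $\phi(L,R)$ in position $(L,R)$. The vertical map $\rho:X\to X$ is $\rho(\mathbf{x})_i=x_i+1$ if $x_i\in\mathbb{Z}$ and $\rho(\mathbf{x})_i=x_i$ if $x_i=\pm\infty$; it is a bijection. For $n\in\mathbb{Z}$, a configuration $\mathbf{x}\in X$ is a vertical inducing point of order $n$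 for $\Phi$ if $\Phi(\mathbf{x})=\rho^n(\mathbf{x})$. A configuration all of whose entries are $\pm\infty$ is regarded as a vertical inducing point of order $0$ only. *)

(* Defs.v *)
(* The set Z U {-oo, +oo} is rendered as \bar int. *)
From HB Require Import structures.
From mathcomp Require Import all_boot all_order all_algebra.
From mathcomp Require Import boolp constructive_ereal.
Set Implicit Arguments.
Unset Strict Implicit.
Unset Printing Implicit Defensive.
Import Order.TTheory GRing.Theory Num.Theory.
Local Open Scope ring_scope.

Definition config : Type := int -> \bar int.

Definition gradients : seq (\bar int) :=
  [:: -oo%E; (-1)%:E; 0%:E; 1%:E; +oo%E].

Definition gradient : Type := {g : \bar int | g \in gradients}.

Definition step : Type := {z : int | -2 <= z <= 2}.

(* phi L R is the entry of the 5 x 5 table in row L (left gradient)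
   and column R (right gradient). *)
Definition local_rule : Type := gradient -> gradient -> step.

Definition beta_val (m : int) (n : \bar int) : \bar int :=
  if ((m + 1)%:E < n)%E then +oo%E
  else if (n < (m - 1)%:E)%E then -oo%E
  else (n - m%:E)%E.

Lemma beta_val_gradients (m : int) (n : \bar int) :
  beta_val m n \in gradients.
Proof.
rewrite /beta_val; case: ifP => [//|/negbT]; rewrite -leNgt => nm.
case: ifP => [//|/negbT]; rewrite -leNgt.
case: n nm => [n| |] //; rewrite !lee_fin => nm mn.
suff: (n - m == -1) || (n - m == 0) || (n - m == 1).
  by rewrite -EFinB !inE !eqe => /orP[/orP[]|] ->; rewrite ?orbT.
move: nm mn; rewrite [m + 1]addrC -lerBlDr [m - 1]addrC -(lerBrDr (-1)).
by case: (n - m) => [[|[|k]]|[|k]].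
Qed.

Definition beta (m : int) (n : \bar int) : gradient :=
  exist _ (beta_val m n) (beta_val_gradients m n).

Definition sand_automaton (phi : local_rule) (x : config) : config :=
  fun i => match x i with
           | EFin a =>
               (a + sval (phi (beta a (x (i - 1))) (beta a (x (i + 1)))))%:E
           | _ => x i
           end.

Definition rho (x : config) : config :=
  fun i => match x i with EFin a => (a + 1)%:E | _ => x i end.

Definition rho_inv (x : config) : config :=
  fun i => match x i with EFin a => (a - 1)%:E | _ => x i end.

Lemma rhoK : cancel rho rho_inv.
Proof.
by move=> x; apply: funext => i; rewrite /rho_inv /rho; case: (x i) => //= a;
   rewrite addrK.
Qed.

Lemma rho_invK : cancel rho_inv rho.
Proof.
by move=> x; apply: funext => i; rewrite /rho_inv /rho; case: (x i) => //= a;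
   rewrite subrK.
Qed.

(* Negz k is the integer -(k.+1). *)
Definition rho_pow (n : int) : config -> config :=
  match n with
  | Posz k => iter k rho
  | Negz k => iter k.+1 rho_inv
  end.

(* A configuration without finite entry is fixed by every power of rho;
   by convention it only counts as an inducing point of order 0. *)
Definition vertical_inducing_point (Phi : config -> config) (n : int)
    (x : config) : Prop :=
  Phi x = rho_pow n x /\ ((forall i, x i = -oo%E \/ x i = +oo%E) -> n = 0).

(* Main.v *)
Require Import Defs.
From HB Require Import structures.
From mathcomp Require Import all_boot all_order all_algebra.
From mathcomp Require Import boolp constructive_ereal.
Set Implicit Arguments.
Unset Strict Implicit.
Unset Printing Implicit Defensive.
Import Order.TTheory GRing.Theory Num.Theory.
Local Open Scope ring_scope.

(** The inducing point is a configuration with finite heights [h] at which the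
    local rule returns [m] everywhere, so that it is lifted by [m].  Suppose
    that [m] occurs in every row, say [phi L (f L) = m].  If a site sees [L]
    on its left and its right neighbour is placed so that it sees [f L] on its
    right, then the left gradient of that neighbour is forced to be
    [g L := beta 0 (- slope (f L))], where [slope R] is a height difference
    that is seen as [R]; infinite gradients are realised by differences of
    [2] or [-2], so all heights stay finite.  Any initial gradient thus
    extends to the right, by iterating [g].  To extend to the left as well,
    start at a periodic point of [g], which exists because there are only five
    gradients ([gradient_periodic_point]): its orbit is two-sided
    ([periodic_orbit_int]), and summing the slopes along it gives the heights
    ([int_antidifference]).  The statement on columns is the mirror image. *)

(** * Two-sided sequences *)

Lemma Posz_addn1 (k : nat) : Posz k + 1 = Posz k.+1.
Proof. by rewrite intS addrC. Qed.

Lemma NegzS_addn1 (k : nat) : Negz k.+1 + 1 = Negz k.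
Proof. by rewrite !NegzE [k.+2%:Z]intS opprD addrAC addNr add0r. Qed.

(** Along a periodic orbit of period [p], the map [iter p.-1 g] undoes [g], so
    the orbit also extends to negative times. *)
Lemma periodic_orbit_int (T : Type) (g : T -> T) (s : T) (p : nat) :
  (0 < p)%N -> iter p g s = s ->
  exists L : int -> T, forall i, L (i + 1) = g (L i).
Proof.
case: p => // p _ gs.
exists (fun i => match i with
                 | Posz k => iter k g s
                 | Negz k => iter (k.+1 * p) g s
                 end).
case=> [k|[|k]].
- by rewrite Posz_addn1.
- by rewrite (_ : Negz 0 + 1 = Posz 0) // mul1n -iterS gs.
rewrite NegzS_addn1 -iterS.
(* This is where the full period is absorbed: [(k.+2 * p).+1] is
   [k.+1 * p + p.+1]. *)
by rewrite [in RHS]mulSn -addSn addnC iterD gs.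
Qed.

Lemma int_antidifference (V : zmodType) (d : int -> V) :
  exists h : int -> V, forall i, h (i + 1) = h i + d i.
Proof.
exists (fun i => match i with
                 | Posz k => \sum_(j < k) d j
                 | Negz k => - \sum_(j < k.+1) d (Negz j)
                 end).
case=> [k|[|k]].
- by rewrite Posz_addn1 big_ord_recr.
- by rewrite (_ : Negz 0 + 1 = Posz 0) // big_ord1 addNr big_ord0.
by rewrite NegzS_addn1 [in RHS]big_ord_recr opprD addrNK.
Qed.

(** * Gradients *)

(** Pigeonhole: six consecutive iterates cannot all be distinct. *)
Lemma gradient_periodic_point (g : gradient -> gradient) :
  exists (s : gradient) (p : nat), (0 < p)%N /\ iter p g s = s.
Proof.
pose s0 := beta 0 0%:E.
have : looping g s0 5.
  apply/negPn; rewrite -looping_uniq; apply/negP => uniq_orbit.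
  have uniq_vals : uniq (map val (traject g s0 6)).
    by rewrite map_inj_uniq //; exact: val_inj.
  suff : (6 <= size gradients)%N by [].
  rewrite -(size_traject g s0 6) -(size_map val).
  by apply: uniq_leq_size => // _ /mapP[R _ ->]; exact: valP R.
case/trajectP=> i i_lt5 iter_eq.
exists (iter i g s0), (5 - i)%N; split; first by rewrite subn_gt0.
by rewrite -iterD subnK ?iter_eq // ltnW.
Qed.

(** Differences of absolute value at least [2] are seen as infinite; [2] and
    [-2] are the smallest such, and keep the heights finite. *)
Definition slope (R : gradient) : int :=
  match sval R with
  | EFin a => a
  | +oo%E => 2
  | -oo%E => -2
  end.

Lemma beta_slope (R : gradient) : beta 0 (slope R)%:E = R.
Proof.
apply: val_inj; case: R => R /= R_grad; rewrite /slope /=.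
by move: R_grad; rewrite !inE => /orP[|/or4P[]] /eqP ->.
Qed.

Lemma beta_shift (a d : int) : beta a (a + d)%:E = beta 0 d%:E.
Proof.
apply: val_inj => /=; rewrite /beta_val !lte_fin -!EFinB.
by rewrite !ltrD2l add0r sub0r subr0 [a + d]addrC addrK.
Qed.

Lemma rho_pow_fin (n : int) (h : int -> int) :
  rho_pow n (fun i => (h i)%:E) = fun i => (h i + n)%:E.
Proof.
case: n => k; last rewrite /rho_pow.
  elim: k => [|k IHk]; first by apply: funext => i; rewrite addr0.
  by apply: funext => i; rewrite /= [iter _ _ _]IHk /rho -Posz_addn1 addrA.
elim: k => [|k IHk]; first by [].
by rewrite iterS IHk; apply: funext => i; rewrite /rho_inv -NegzS_addn1 addrA addrK.
Qed.

(** * Heights on which the local rule is constant *)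

Lemma heights_of_rows (phi : local_rule) (m : int) :
  (forall L, exists R, sval (phi L R) = m) ->
  exists h : int -> int, forall i,
    sval (phi (beta (h i) (h (i - 1))%:E) (beta (h i) (h (i + 1))%:E)) = m.
Proof.
move=> /choice[f phi_f].
pose g L := beta 0 (- slope (f L))%:E.
have [s [p [p_gt0 gs]]] := gradient_periodic_point g.
have [L LS] := periodic_orbit_int p_gt0 gs.
have [h hS] := int_antidifference (fun i => slope (f (L i))).
exists h => i.
have -> : beta (h i) (h (i + 1))%:E = f (L i) by rewrite hS beta_shift beta_slope.
suff -> : beta (h i) (h (i - 1))%:E = L i by [].
have := hS (i - 1); have := LS (i - 1); rewrite subrK => -> ->.
by rewrite /g -[in RHS](beta_shift (h (i - 1) + slope (f (L (i - 1))))) addrK.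
Qed.

(** Reflecting the line exchanges left and right, hence transposes the table. *)
Lemma heights_of_columns (phi : local_rule) (m : int) :
  (forall R, exists L, sval (phi L R) = m) ->
  exists h : int -> int, forall i,
    sval (phi (beta (h i) (h (i - 1))%:E) (beta (h i) (h (i + 1))%:E)) = m.
Proof.
move=> /(@heights_of_rows (fun L R => phi R L))[h h_m].
exists (fun i => h (- i)) => i.
by rewrite opprB [- (i + 1)]opprD [1 - i]addrC; exact: h_m.
Qed.

Theorem theorem4p4 (phi : local_rule) :
  (exists m : int, m <> 0 /\
     ((forall L : gradient, exists R : gradient, sval (phi L R) = m) \/
      (forall R : gradient, exists L : gradient, sval (phi L R) = m))) ->
  exists (n : int) (x : config),
    n <> 0 /\ vertical_inducing_point (sand_automaton phi) n x.
Proof.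
move=> [m [m_neq0 m_in]].
have [h h_m] : exists h : int -> int, forall i,
    sval (phi (beta (h i) (h (i - 1))%:E) (beta (h i) (h (i + 1))%:E)) = m.
  by case: m_in => [/heights_of_rows|/heights_of_columns].
exists m, (fun i => (h i)%:E); split=> //; split.
  by rewrite rho_pow_fin; apply: funext => i; rewrite /sand_automaton h_m.
by move=> /(_ 0)[].
Qed.
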